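(* Let $\mathfrak W=(W,+,0)$ be a commutative monoid, $A$ a set of labels, $\Sigma$ a process signature and $\Theta$ a weight signature, and let $\langle\mathcal R,(\!|{-}|\!)\rangle$ be an image-finite WFSOS specification over $\mathfrak W,\Sigma,\Theta$. Then behavioural equivalence (bisimilarity) on the $\mathfrak W$-ULTraS induced by this specification on the set $T^\Sigma\emptyset$ of ground $\Sigma$-terms is a congruence with respect to the operators of the process signature $\Sigma$.
   Context: A $\mathfrak W$-ULTraS is a triple $(X,A,\to)$ with $\to\subseteq X\times A\times[X\to W]$; transitions $x\xrightarrow{a}\rho$ lead to state reachability weight functions $\rho$. $\mathcal F_W X$ denotes the set of finitely supported functions $X\to W$. Bisimulation: an equivalence $R$ such that $(x,y)\in R$ implies, for each label $a$, every $x\xrightarrow{a}\varphi$ is matched by some $y\xrightarrow{a}\psi$ with $\varphi(C)=\psi(C)$ for every equivalence class $C$ of $R$ (and symmetrically), where $\rho(C)=\sum_{z\in C}\rho(z)$. A WFSOS rule has conclusion $\mathtt f(x_1,\dots,x_n)\xrightarrow{c}\psi$, with $\psi$ a $\Theta$-term over process and weight-function variables, and premises of four kinds: $x_i\xrightarrow{a}\varphi^a_{ij}$, $x_i\not\xrightarrow{b}$, total-weight constraints $\|\varphi\|=w_k$, and support premises $y_k\in\mathrm{supp}(\varphi)$ (the latter only when $\mathfrak W$ is zerosumfree). A weight term interpretation is a family of maps $(\!|{-}|\!)_X: T^\Theta(X+\mathcal F_W X)\to\mathcal F_W T^\Sigma X$ commuting with substitutions. An image-finite WFSOS specification is a pair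 $\langle\mathcal R,(\!|{-}|\!)\rangle$ of a set of such rules, with only finitely many rules sharing operator, conclusion label and trigger, and an interpretation. The induced ULTraS on ground terms $T^\Sigma\emptyset$ is defined by structural recursion: each applicable rule instance yields $p\xrightarrow{c}(\!|\psi[\theta]|\!)[\sigma]$. *)

(* Defs.v *)
From HB Require Import structures.
From Stdlib Require Import RelationClasses.
From mathcomp Require Import all_boot all_order all_algebra finmap.
From mathcomp Require Import all_classical.

Set Implicit Arguments.
Unset Strict Implicit.
Unset Printing Implicit Defensive.

Import GRing.Theory.
Local Open Scope classical_set_scope.
Local Open Scope ring_scope.

(* Commutative monoids are [nmodType]s and sets are [choiceType]s; the latter
   is no restriction, since in the presence of [boolp] every type carries a
   choice structure. *)

Definition zerosumfree (W : nmodType) : Prop :=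
  forall v w : W, v + w = 0 -> v = 0 /\ w = 0.

(* The sum is total: it is [0] when [rho] has infinite support in [C].  It is
   only used at weight functions that are finitely supported. *)
Definition weight (W : nmodType) (X : choiceType) (rho : X -> W) (C : set X) : W :=
  \sum_(z \in C) rho z.

Definition total_weight (W : nmodType) (X : choiceType) (rho : X -> W) : W :=
  weight rho setT.

Definition ultras (W : nmodType) (A : Type) (X : choiceType) : Type :=
  X -> A -> (X -> W) -> Prop.

Definition bisimulation (W : nmodType) (A : Type) (X : choiceType)
    (tr : ultras W A X) (R : X -> X -> Prop) : Prop :=
  Equivalence R /\
  forall x y, R x y -> forall a,
    (forall phi, tr x a phi -> exists psi, tr y a psi /\
       forall z, weight phi [set u | R z u] = weight psi [set u | R z u]) /\
    (forall psi, tr y a psi -> exists phi, tr x a phi /\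
       forall z, weight phi [set u | R z u] = weight psi [set u | R z u]).

Definition bisimilar (W : nmodType) (A : Type) (X : choiceType)
    (tr : ultras W A X) (x y : X) : Prop :=
  exists R, bisimulation tr R /\ R x y.

Record signature : Type := Signature {
  op :> Type;
  arity : op -> nat
}.

Inductive term (S : signature) (X : Type) : Type :=
| Var of X
| Op (f : S) (args : 'I_(arity f) -> term S X).

Arguments Op {S X} f args.

HB.instance Definition _ (S : signature) (X : Type) := gen_eqMixin (term S X).
HB.instance Definition _ (S : signature) (X : Type) := gen_choiceMixin (term S X).

Fixpoint subst (S : signature) (X Y : Type) (g : X -> term S Y) (t : term S X) :
    term S Y :=
  match t with
  | Var x => g x
  | Op f args => Op f (fun i => subst g (args i))
  end.

Definition rename (S : signature) (X Y : Type) (g : X -> Y) : term S X -> term S Y :=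
  subst (fun x => Var S (g x)).

Definition ground (S : signature) : choiceType := term S void.

Definition congruence (S : signature) (R : ground S -> ground S -> Prop) : Prop :=
  Equivalence R /\
  forall (f : S) (p q : 'I_(arity f) -> ground S),
    (forall i, R (p i) (q i)) -> R (Op f p) (Op f q).

(* [finw W X] is the set $\mathcal F_W X$. *)
Definition finw (W : nmodType) (X : choiceType) : choiceType :=
  {fsfun X -> W with 0}.

(* The action of the functor $\mathcal F_W$ on maps. *)
Definition pushforward (W : nmodType) (X Y : choiceType) (g : X -> Y)
    (rho : finw W X) : finw W Y :=
  [fsfun y in [fset g x | x in finsupp rho]%fset => weight rho [set x | g x = y]].

(* The action of the functor $X + \mathcal F_W X$ on maps. *)
Definition rename_arg (W : nmodType) (X Y : choiceType) (g : X -> Y)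
    (v : X + finw W X) : Y + finw W Y :=
  match v with
  | inl x => inl (g x)
  | inr rho => inr (pushforward g rho)
  end.

Record interpretation (W : nmodType) (Sigma Theta : signature) : Type :=
  Interpretation {
    interp : forall X : choiceType, term Theta (X + finw W X) -> finw W (term Sigma X);
    interp_subst : forall (X Y : choiceType) (g : X -> Y) (t : term Theta (X + finw W X)),
      interp (rename (rename_arg g) t) = pushforward (rename g) (interp t)
  }.

(* The variables of a rule are positional, hence pairwise distinct: [x_i] is
   indexed by [i : 'I_(arity f)], [y_k] by [k : 'I_q], where [q] is the number
   of support premises, and [phi^a_ij] by the triple [(i, a, j)], where
   [j < mult i a]. *)
Definition wvar (A : Type) (n : nat) (mult : 'I_n -> A -> nat) : Type :=
  {i : 'I_n & {a : A & 'I_(mult i a)}}.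

(* A rule with source [f(x_1, ..., x_n)] and conclusion label [r_label]. Its
   premises are:
   - [x_i -a-> phi^a_ij] for all [i], [a] and [j < r_mult i a];
   - [x_i -b-/->] for all [i] and [b] in [r_neg i];
   - [|| r_cvar k || = r_cval k] for [k < r_p];
   - [y_k \in supp (r_svar k)] for [k < r_q]. *)
Record rule (W : nmodType) (A : Type) (Sigma Theta : signature) (f : Sigma) : Type :=
  Rule {
    r_mult : 'I_(arity f) -> A -> nat;
    r_neg : 'I_(arity f) -> set A;
    r_p : nat;
    r_cvar : 'I_r_p -> wvar r_mult;
    r_cval : 'I_r_p -> W;
    r_q : nat;
    r_svar : 'I_r_q -> wvar r_mult;
    r_zerosumfree : (0 < r_q)%N -> zerosumfree W;
    r_label : A;
    r_target : term Theta (('I_(arity f) + 'I_r_q) + wvar r_mult)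
  }.

Arguments r_cvar {W A Sigma Theta f} r k.
Arguments r_cval {W A Sigma Theta f} r k.
Arguments r_svar {W A Sigma Theta f} r k.
Arguments r_neg {W A Sigma Theta f} r i _.

(* The tuples $\langle A_1,\dots,A_n\rangle$, $\langle w_1,\dots,w_p\rangle$ of
   the sets of labels that the positive premises require to be enabled and of
   the required total weights. *)
Definition trigger (W : nmodType) (A : Type) (Sigma Theta : signature) (f : Sigma)
    (r : rule W A Theta f) : ('I_(arity f) -> set A) * seq W :=
  (fun i => [set a | (0 < r_mult r i a)%N], [seq r_cval r k | k <- enum 'I_(r_p r)]).

Record specification (W : nmodType) (A : Type) (Sigma Theta : signature) : Type :=
  Specification {
    rules : forall f : Sigma, set (rule W A Theta f);
    wt_interp : interpretation W Sigma Theta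
  }.

Definition image_finite (W : nmodType) (A : Type) (Sigma Theta : signature)
    (E : specification W A Sigma Theta) : Prop :=
  forall (f : Sigma) (c : A) (t : ('I_(arity f) -> set A) * seq W),
    finite_set [set r | rules E r /\ r_label r = c /\ trigger r = t].

(* $(\!|\psi[\theta]|\!)[\sigma]$.  Ground terms are added to the process
   variables [V] as extra, inert variables, so that [theta], whose values are
   weight functions on ground terms, can be applied before the interpretation;
   [sigma] is then extended by the identity on ground terms. *)
Definition target_weight (W : nmodType) (Sigma Theta : signature) (V : choiceType)
    (Phi : Type) (I : interpretation W Sigma Theta) (sigma : V -> ground Sigma)
    (theta : Phi -> finw W (ground Sigma)) (psi : term Theta (V + Phi)) :
    finw W (ground Sigma) :=
  let Z : choiceType := (V + ground Sigma)%type in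
  let instantiate (v : V + Phi) : Z + finw W Z :=
    match v with
    | inl x => inl (inl x)
    | inr phi => inr (pushforward inr (theta phi))
    end in
  let close (z : Z) : ground Sigma :=
    match z with inl x => sigma x | inr p => p end in
  pushforward (subst close) (interp I (rename instantiate psi)).

Fixpoint induced (W : nmodType) (A : Type) (Sigma Theta : signature)
    (E : specification W A Sigma Theta) (t : ground Sigma) (c : A)
    (rho : ground Sigma -> W) : Prop :=
  match t with
  | Var _ => False
  | Op f p =>
      exists (r : rule W A Theta f) (sigma : 'I_(arity f) + 'I_(r_q r) -> ground Sigma)
          (theta : wvar (r_mult r) -> finw W (ground Sigma)),
        rules E r /\ r_label r = c /\
        (forall i, sigma (inl i) = p i) /\
        (forall i a (j : 'I_(r_mult r i a)),
            induced E (p i) a (theta (existT _ i (existT _ a j)))) /\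
        (forall i b, r_neg r i b -> ~ exists phi, induced E (p i) b phi) /\
        (forall k, total_weight (theta (r_cvar r k)) = r_cval r k) /\
        (forall k, sigma (inr k) \in finsupp (theta (r_svar r k))) /\
        rho = target_weight (wt_interp E) sigma theta (r_target r)
  end.

Definition induced_ultras (W : nmodType) (A : Type) (Sigma Theta : signature)
    (E : specification W A Sigma Theta) : ultras W A (ground Sigma) :=
  fun p a rho => induced E p a rho.

(* Main.v *)
(* The congruence closure R of bisimilarity is itself a bisimulation, hence
   equals bisimilarity.  By induction on the closure, the only substantial case
   is f(p) R f(q) with p_i R q_i: a rule instance at f(p) is transported to f(q)
   by replacing each weight function phi by one that agrees with it on all
   classes of R.  Choosing a canonical representative in each class turns this
   agreement into equality of pushforwards, and naturality of the
   interpretation together with R being a congruence shows that the two targets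
   have equal pushforwards as well.  Zerosumfreeness makes "the class of y meets
   the support" a property of the total weight of the class, so that support
   premises are transported too. *)
Require Import Defs.
From Stdlib Require Import RelationClasses.
From mathcomp Require Import all_boot all_order all_algebra finmap.
From mathcomp Require Import all_classical.

Set Implicit Arguments.
Unset Strict Implicit.
Unset Printing Implicit Defensive.

Import GRing.Theory.
Local Open Scope classical_set_scope.
Local Open Scope ring_scope.

(** * Weights and pushforwards of finitely supported functions *)

Lemma weight_finsupp (W : nmodType) (X : choiceType) (rho : finw W X) (C : set X) :
  weight rho C = \sum_(z <- finsupp rho | z \in C) rho z.
Proof.
rewrite /weight fsbig_mkcond (fsbigTE (finsupp rho)) => [|z /fsfun_dflt rho0].
  by rewrite [RHS]big_mkcond.
by rewrite /patch rho0 if_same.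
Qed.

Lemma pushforwardE (W : nmodType) (X Y : choiceType) (g : X -> Y) (rho : finw W X) y :
  pushforward g rho y = weight rho [set x | g x = y].
Proof.
(* Outside the image of the support, the fibre over [y] misses the support, so its weight is the
   default value 0. *)
rewrite fsfun_fun; case: ifPn => // /negP yNg.
rewrite weight_finsupp big1_seq // => x /andP[/set_mem /= gx xrho].
by case: yNg; rewrite -gx; apply/imfsetP; exists x.
Qed.

Lemma weight_pushforward (W : nmodType) (X Y : choiceType) (g : X -> Y)
    (rho : finw W X) (C : set Y) :
  weight (pushforward g rho) C = weight rho (g @^-1` C).
Proof.
pose G := [fset g x | x in finsupp rho]%fset.
have -> : weight (pushforward g rho) C =
    \sum_(y <- G | y \in C) pushforward g rho y.
  rewrite /weight fsbig_mkcond (fsbigTE G) => [|y yG].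
    by rewrite [RHS]big_mkcond.
  by rewrite /patch fsfun_fun (negbTE yG) if_same.
rewrite weight_finsupp [RHS]big_mkcond (partition_big_imfset _ g) [LHS]big_mkcond /=.
apply: eq_bigr => y _; rewrite pushforwardE weight_finsupp.
rewrite -big_mkcondr; case: ifPn => yC; last first.
  rewrite big1 // => x /andP[/eqP gx /set_mem /= gxC].
  by move: yC; rewrite -gx mem_set.
apply: eq_bigl => x; apply/idP/andP => [/set_mem /= gx|[/eqP gx _]].
  by split; [exact/eqP|apply/mem_set => /=; rewrite gx; exact: set_mem].
exact/mem_set.
Qed.

Lemma pushforward_comp (W : nmodType) (X Y Z : choiceType) (g : Y -> Z) (f : X -> Y)
    (rho : finw W X) :
  pushforward g (pushforward f rho) = pushforward (g \o f) rho.
Proof. by apply/fsfunP => z; rewrite !pushforwardE weight_pushforward. Qed.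

Lemma subst_rename (S : signature) (X Y Z : Type) (g : Y -> term S Z) (f : X -> Y) t :
  subst g (rename f t) = subst (g \o f) t.
Proof. by elim: t => //= o args IH; congr Op; apply/funext. Qed.

Lemma congruence_subst (S : signature) (R : ground S -> ground S -> Prop) (X : Type)
    (g h : X -> ground S) t :
  congruence R -> (forall x, R (g x) (h x)) -> R (subst g t) (subst h t).
Proof. by move=> [_ Rop] Rgh; elim: t => //= o p IH; apply: Rop. Qed.

(** * Class representatives, and supports under zerosumfreeness *)

Definition class_repr (X : choiceType) (R : X -> X -> Prop) (x : X) : X :=
  choose (fun y => `[<R x y>]) x.

Section ClassRepr.
Context (X : choiceType) (R : X -> X -> Prop) (HR : Equivalence R).

Lemma class_reprP x : R x (class_repr R x).
Proof.
apply: asboolW; apply: (@chooseP _ (fun y => `[<R x y>])).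
by apply/asboolP; reflexivity.
Qed.

(** Related points define the same predicate, and the value of [choose] depends on the predicate
    only, not on the witness supplied. *)
Lemma class_repr_eq x y : R x y -> class_repr R x = class_repr R y.
Proof.
move=> Rxy; rewrite /class_repr (@eq_choose _ _ (fun z => `[<R y z>])).
  by apply: choose_id; apply/asboolP; [symmetry|reflexivity].
move=> z; apply/asboolP/asboolP => H; last by transitivity y.
by transitivity x => //; symmetry.
Qed.

Lemma preimage_class_repr (C : set X) :
  (forall x y, R x y -> C x -> C y) -> class_repr R @^-1` C = C.
Proof.
move=> Csat; apply/seteqP; split=> x /=; apply: Csat; last exact: class_reprP.
by symmetry; exact: class_reprP.
Qed.

Lemma eq_weight_saturated (W : nmodType) (phi psi : finw W X) (C : set X) :
  (forall x y, R x y -> C x -> C y) ->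
  pushforward (class_repr R) phi = pushforward (class_repr R) psi ->
  weight phi C = weight psi C.
Proof.
by move=> Csat e; rewrite -(preimage_class_repr Csat) -!(weight_pushforward (class_repr R)) e.
Qed.

(** The fibre of [class_repr R] over a representative is its whole class, and every other fibre is
    empty; the values of the pushforward are thus the class weights. *)
Lemma eq_pushforward_class_repr (W : nmodType) (phi psi : finw W X) :
  (forall z, weight phi [set u | R z u] = weight psi [set u | R z u]) <->
  pushforward (class_repr R) phi = pushforward (class_repr R) psi.
Proof.
split=> e; last first.
  by move=> z; apply: eq_weight_saturated e => x y Rxy /= Rzx; transitivity x.
apply/fsfunP => y; rewrite !pushforwardE.
have [[x <-]|yN] := pselect (exists x, class_repr R x = y); last first.
  suff -> : [set x | class_repr R x = y] = set0.
    by rewrite !weight_finsupp !big1 // => z; rewrite inE.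
  by apply/seteqP; split=> x //= xy; case: yN; exists x.
suff -> : [set u | class_repr R u = class_repr R x] = [set u | R x u] by exact: e.
apply/seteqP; split=> u /= => [e'|Rxu]; last by symmetry; exact: class_repr_eq.
transitivity (class_repr R u); last by symmetry; exact: class_reprP.
by rewrite e'; exact: class_reprP.
Qed.

End ClassRepr.

(** In a zerosumfree monoid a nonzero summand cannot be cancelled by the remaining ones. *)
Lemma zerosumfree_supp (W : nmodType) (X : choiceType) (rho : finw W X) (C : set X) :
  zerosumfree W -> weight rho C != 0 <-> exists2 x, C x & x \in finsupp rho.
Proof.
move=> W0; split=> [|[x Cx xrho]]; last first.
  rewrite weight_finsupp (big_rem x) //= mem_set //.
  by apply/eqP => /W0[rho0 _]; move: xrho; rewrite mem_finsupp rho0 eqxx.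
apply: contra_neqP => Crho; rewrite weight_finsupp big1_seq // => x /andP[/set_mem Cx xrho].
by case: Crho; exists x.
Qed.

(** * Target weights modulo a congruence *)

Section TargetWeight.
Context (W : nmodType) (Sigma Theta : signature) (V : choiceType) (Phi : Type).
Context (I : interpretation W Sigma Theta) (psi : term Theta (V + Phi)).
Context (R : ground Sigma -> ground Sigma -> Prop) (HR : congruence R).

Let eqR : Equivalence R := HR.1.
#[local] Existing Instance eqR.

(** Normalising [theta] amounts to renaming the inert ground terms along [h], which fixes the
    process variables. Naturality moves this renaming past the interpretation, where it only
    replaces leaves by [R]-related ones; the congruence [R] does not see that. *)
Lemma target_weight_class_repr (sigma : V -> ground Sigma)
    (theta : Phi -> finw W (ground Sigma)) :
  pushforward (class_repr R) (target_weight I sigma theta psi) =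
  pushforward (class_repr R)
    (target_weight I sigma (pushforward (class_repr R) \o theta) psi).
Proof.
pose h (z : V + ground Sigma) : V + ground Sigma :=
  match z with inl x => inl x | inr p => inr (class_repr R p) end.
rewrite /target_weight; set inst := fun v : V + Phi => _; set close := fun z => _.
set inst' := (X in _ = pushforward _ (pushforward _ (interp I (rename X psi)))).
have -> : rename inst' psi = rename (rename_arg h) (rename inst psi).
  rewrite [RHS]subst_rename; congr subst; apply/funext => -[x|u] //=.
  by rewrite !pushforward_comp.
rewrite interp_subst !pushforward_comp; congr pushforward; apply/funext => t /=.
apply: (class_repr_eq eqR); rewrite subst_rename.
apply: congruence_subst => // -[x|p] /=; last exact: class_reprP.
by reflexivity.
Qed.

Lemma target_weight_congr (sigma sigma' : V -> ground Sigma)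
    (theta theta' : Phi -> finw W (ground Sigma)) :
  (forall x, R (sigma x) (sigma' x)) ->
  (forall u, pushforward (class_repr R) (theta u) =
             pushforward (class_repr R) (theta' u)) ->
  pushforward (class_repr R) (target_weight I sigma theta psi) =
  pushforward (class_repr R) (target_weight I sigma' theta' psi).
Proof.
move=> Rsigma etheta; rewrite target_weight_class_repr [RHS]target_weight_class_repr.
(* Once normalised, the two assignments coincide, and only [sigma] and [sigma'] still differ. *)
have -> : pushforward (class_repr R) \o theta = pushforward (class_repr R) \o theta'.
  exact/funext.
rewrite /target_weight !pushforward_comp; congr pushforward; apply/funext => t /=.
apply: (class_repr_eq eqR); apply: congruence_subst => // -[x|p] //=.
by reflexivity.
Qed.

End TargetWeight.

(** * One-sided simulation and transport of rule instances *)

Definition simulates (W : nmodType) (A : Type) (X : choiceType) (tr : ultras W A X)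
    (R : X -> X -> Prop) (x y : X) : Prop :=
  forall a phi, tr x a phi -> exists psi, tr y a psi /\
    forall z, weight phi [set u | R z u] = weight psi [set u | R z u].

Lemma bisimulationP (W : nmodType) (A : Type) (X : choiceType) (tr : ultras W A X)
    (R : X -> X -> Prop) :
  bisimulation tr R <->
  Equivalence R /\ forall x y, R x y -> simulates tr R x y /\ simulates tr R y x.
Proof.
split=> -[eqR sim]; split=> // x y Rxy.
  split=> a phi xphi; first exact: (sim x y Rxy a).1.
  have [psi [ypsi e]] := (sim x y Rxy a).2 _ xphi.
  by exists psi; split=> // z; rewrite e.
have [xy yx] := sim x y Rxy; move=> a; split=> phi; first exact: xy.
by move=> /yx[psi [xpsi e]]; exists psi; split=> // z; rewrite e.
Qed.

Section Induced.
Context (W : nmodType) (A : Type) (Sigma Theta : signature).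
Context (E : specification W A Sigma Theta).

Lemma induced_finw p a rho :
  induced E p a rho -> exists phi : finw W (ground Sigma), rho = phi.
Proof.
case: p => // f p [r [sigma [theta [_ [_ [_ [_ [_ [_ [_ ->]]]]]]]]]].
by eexists.
Qed.

Lemma simulates_class_repr (R : ground Sigma -> ground Sigma -> Prop) p q a
    (phi : finw W (ground Sigma)) :
  Equivalence R -> simulates (induced_ultras E) R p q -> induced E p a phi ->
  exists psi : finw W (ground Sigma), induced E q a psi /\
    pushforward (class_repr R) phi = pushforward (class_repr R) psi.
Proof.
move=> eqR sim pphi; have [rho [qrho e]] := sim _ _ pphi.
have [psi rhoE] := induced_finw qrho.
exists psi; rewrite -rhoE; split=> //.
by apply/eq_pushforward_class_repr; rewrite -?rhoE.
Qed.

(** Both directions are needed at the arguments: the forward one matches positive premises, the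
    backward one preserves negative premises. *)
Lemma simulates_op (R : ground Sigma -> ground Sigma -> Prop) (f : Sigma)
    (p q : 'I_(arity f) -> ground Sigma) :
  congruence R -> (forall i, R (p i) (q i)) ->
  (forall i, simulates (induced_ultras E) R (p i) (q i)) ->
  (forall i, simulates (induced_ultras E) R (q i) (p i)) ->
  simulates (induced_ultras E) R (Op f p) (Op f q).
Proof.
move=> HR Rpq simpq simqp c rho /= [r [sigma [theta]]].
move=> [rE [rc [sigmap [pos [neg [tot [supp ->]]]]]]].
have eqR := HR.1.
have /choice[theta' theta'P] : forall u : wvar (r_mult r),
    exists psi : finw W (ground Sigma),
    induced E (q (tag u)) (tag (tagged u)) psi /\
    pushforward (class_repr R) (theta u) = pushforward (class_repr R) psi.
  by move=> [i [a j]]; apply: simulates_class_repr (pos i a j).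
have etheta u := (theta'P u).2.
(* The class of [sigma (inr k)] meets the support of [theta], so it has nonzero weight under [theta]
   and hence under [theta']; some [y] in it therefore supports [theta']. *)
have /choice[y yP] : forall k, exists y,
    R (sigma (inr k)) y /\ y \in finsupp (theta' (r_svar r k)).
  move=> k; have W0 := @r_zerosumfree _ _ _ _ _ r (leq_ltn_trans (leq0n k) (ltn_ord k)).
  have [z Rz zsupp] : exists2 z, R (sigma (inr k)) z & z \in finsupp (theta' (r_svar r k)).
    apply/(zerosumfree_supp (theta' (r_svar r k)) (R (sigma (inr k))) W0).
    rewrite -(eq_weight_saturated eqR _ (etheta _)); last first.
      by move=> x z Rxz Rx; transitivity x.
    by apply/(zerosumfree_supp _ _ W0); exists (sigma (inr k)) => //; reflexivity.
  by exists z.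
pose sigma' (v : 'I_(arity f) + 'I_(r_q r)) :=
  match v with inl i => q i | inr k => y k end.
exists (target_weight (wt_interp E) sigma' theta' (r_target r)); split; last first.
  apply/eq_pushforward_class_repr => //; apply: target_weight_congr => // -[i|k] /=.
    by rewrite sigmap.
  exact: (yP k).1.
exists r, sigma', theta'; do 3![split=> //]; split; last split; last split; last split=> //.
- by move=> i a j; exact: (theta'P (existT _ i (existT _ a j))).1.
- move=> i b rb [psi qpsi]; apply: (neg i b rb).
  have [psiF psiE] := induced_finw qpsi; rewrite psiE in qpsi.
  by have [phi [pphi _]] := simulates_class_repr eqR (simqp i) qpsi; exists phi.
(* The total weight is the weight of [setT], which is trivially saturated. *)
- move=> k; rewrite -tot; apply: esym.
  exact: (eq_weight_saturated eqR _ (etheta _)).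
- by move=> k; exact: (yP k).2.
Qed.

End Induced.

Inductive congruence_closure (S : signature) (B : ground S -> ground S -> Prop) :
    ground S -> ground S -> Prop :=
| closure_base p q : B p q -> congruence_closure B p q
| closure_refl p : congruence_closure B p p
| closure_sym p q : congruence_closure B p q -> congruence_closure B q p
| closure_trans p q s :
    congruence_closure B p q -> congruence_closure B q s -> congruence_closure B p s
| closure_op (f : S) (p q : 'I_(arity f) -> ground S) :
    (forall i, congruence_closure B (p i) (q i)) ->
    congruence_closure B (Op f p) (Op f q).

Lemma congruence_closureP (S : signature) (B : ground S -> ground S -> Prop) :
  congruence (congruence_closure B).
Proof.
split; last exact: closure_op.
by split; [exact: closure_refl|exact: closure_sym|exact: closure_trans].
Qed.

(** Each class of [R] is a union of classes of [S], hence [S]-saturated, so agreement on [S]-classes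
    determines its weight. *)
Lemma simulates_coarsen (W : nmodType) (A : Type) (Sigma Theta : signature)
    (E : specification W A Sigma Theta) (S R : ground Sigma -> ground Sigma -> Prop) p q :
  Equivalence S -> Equivalence R -> (forall x y, S x y -> R x y) ->
  simulates (induced_ultras E) S p q -> simulates (induced_ultras E) R p q.
Proof.
move=> eqS eqR SR sim a phi pphi; have [phiF phiE] := induced_finw pphi.
rewrite {}phiE in pphi *.
have [psi [qpsi e]] := simulates_class_repr eqS sim pphi.
exists psi; split=> // z; apply: (eq_weight_saturated eqS _ e).
by move=> x y /SR Rxy /= Rzx; transitivity x.
Qed.

Lemma simulates_trans (W : nmodType) (A : Type) (X : choiceType) (tr : ultras W A X)
    (R : X -> X -> Prop) x y z :
  simulates tr R x y -> simulates tr R y z -> simulates tr R x z.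
Proof.
move=> xy yz a phi /xy[psi [ypsi e]]; have [chi [zchi e']] := yz a psi ypsi.
by exists chi; split=> // u; rewrite e.
Qed.

Lemma closure_bisimulation (W : nmodType) (A : Type) (Sigma Theta : signature)
    (E : specification W A Sigma Theta) :
  bisimulation (induced_ultras E) (congruence_closure (bisimilar (induced_ultras E))).
Proof.
set R := congruence_closure _; have HR : congruence R := congruence_closureP _.
apply/bisimulationP; split; first exact: HR.1.
move=> p q; elim=> {p q} [p q [S [bisimS Spq]]|p|p q _ [pq qp]|p q s _ [pq qp] _ [qs sq]
  |f p q Rpq IH].
- have SR x y : S x y -> R x y by move=> Sxy; apply: closure_base; exists S.
  have /bisimulationP[eqS simS] := bisimS; have [pq qp] := simS p q Spq.
  by split; apply: (simulates_coarsen eqS HR.1 SR).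
- by split=> a phi pphi; exists phi.
- by split.
- by split; [exact: simulates_trans pq qs|exact: simulates_trans sq qp].
(* The induction hypothesis carries both directions, as [simulates_op] demands; what remains is the
   reversed relation between the arguments. *)
- split; apply: simulates_op => // i; try by have [] := IH i.
  exact: closure_sym.
Qed.

Theorem theorem1 (W : nmodType) (A : Type) (Sigma Theta : signature)
    (E : specification W A Sigma Theta) (HE : image_finite E) :
  congruence (bisimilar (induced_ultras E)).
Proof.
suff -> : bisimilar (induced_ultras E) =
    congruence_closure (bisimilar (induced_ultras E)).
  exact: congruence_closureP.
apply/funext => p; apply/funext => q; apply/propext; split; first exact: closure_base.
by move=> pq; exists (congruence_closure (bisimilar (induced_ultras E)));
   split=> //; exact: closure_bisimulation.
Qed.
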